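(* Let $\lambda$ and $\mathbf{a}=(a_\ell)_{\ell\ge0}$, $\mathbf{b}=(b_{\ell,\ell'})_{\ell,\ell'\ge0}$, $\mathbf{c}=(c_{\ell,\ell'})_{\ell,\ell'\ge0}$, $\mathbf{d}=(d_{\ell,\ell'})_{\ell,\ell'\ge0}$, $\mathbf{e}=(e_\ell)_{\ell\ge0}$ be commuting indeterminates, and for $n\ge0$ let \[ \widehat{Q}_n(\mathbf{a},\mathbf{b},\mathbf{c},\mathbf{d},\mathbf{e},\lambda)=\sum_{\sigma\in\mathfrak{S}_n}\lambda^{\mathrm{cyc}(\sigma)}\prod_{i\in\mathrm{Cval}(\sigma)}a_{\mathrm{ucross}(i,\sigma)+\mathrm{unest}(i,\sigma)}\prod_{i\in\mathrm{Cpeak}(\sigma)}b_{\mathrm{lcross}(i,\sigma),\mathrm{lnest}(i,\sigma)}\prod_{i\in\mathrm{Cdfall}(\sigma)}c_{\mathrm{lcross}(i,\sigma),\mathrm{lnest}(i,\sigma)}\prod_{i\in\mathrm{Cdrise}(\sigma)}d_{\mathrm{ucross}(i,\sigma),\mathrm{unest}(i,\sigma)}\prod_{i\in\mathrm{Fix}(\sigma)}e_{\mathrm{psnest}(i,\sigma)}. \] Then \[ \sum_{n\ge0}\widehat{Q}_n t^n=\cfrac{1}{1-\gamma_0t-\cfrac{\beta_1t^2}{1-\gamma_1t-\cfrac{\beta_2t^2}{1-\cdots}}} \] as formal power series in $t$, where $\gamma_0=\lambda e_0$, $\gamma_n=\sum_{\xi=0}^{n-1}c_{n-1-\xi,\xi}+\sum_{\xi=0}^{n-1}d_{n-1-\xi,\xi}+\lambda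 e_n$ for $n\ge1$, and $\beta_n=(\lambda+n-1)\,a_{n-1}\sum_{\xi=0}^{n-1}b_{n-1-\xi,\xi}$ for $n\ge1$.
   Context: $\mathfrak{S}_n$ is the set of permutations of $[n]$. For $\sigma\in\mathfrak{S}_n$: $\mathrm{Cpeak}(\sigma)=\{i:\sigma^{-1}(i)<i>\sigma(i)\}$, $\mathrm{Cval}(\sigma)=\{i:\sigma^{-1}(i)>i<\sigma(i)\}$, $\mathrm{Cdrise}(\sigma)=\{i:\sigma^{-1}(i)<i<\sigma(i)\}$, $\mathrm{Cdfall}(\sigma)=\{i:\sigma^{-1}(i)>i>\sigma(i)\}$, $\mathrm{Fix}(\sigma)=\{i:\sigma(i)=i\}$. $\mathrm{cyc}(\sigma)$ is the number of cycles (fixed points included). $\mathrm{ucross}(j,\sigma)=\#\{(i,k,l):i<j<k<l,\ k=\sigma(i),\ l=\sigma(j)\}$, $\mathrm{unest}(j,\sigma)=\#\{(i,k,l):i<j<k<l,\ k=\sigma(j),\ l=\sigma(i)\}$, $\mathrm{lcross}(k,\sigma)=\#\{(i,j,l):i<j<k<l,\ i=\sigma(k),\ j=\sigma(l)\}$, $\mathrm{lnest}(k,\sigma)=\#\{(i,j,l):i<j<k<l,\ i=\sigma(l),\ j=\sigma(k)\}$, and for a fixed point $i$, $\mathrm{psnest}(i,\sigma)=\#\{j<i:\sigma(j)>i\}$. *)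

(* Defs.v *)
From mathcomp Require Import all_boot all_order all_algebra all_fingroup.

Set Implicit Arguments.
Unset Strict Implicit.
Unset Printing Implicit Defensive.

Import GRing.Theory.
Local Open Scope ring_scope.

Section CyclicStatistics.
Variables (n : nat) (s : 'S_n).
Implicit Types i j k l : 'I_n.

(* [n] is rendered as 'I_n = {0, ..., n-1}; every statistic below depends only
   on the relative order of the letters, so the shift by one is harmless. *)
Definition Cpeak : {set 'I_n} := [set i : 'I_n | ((s^-1)%g i < i)%N && (s i < i)%N].
Definition Cval : {set 'I_n} := [set i : 'I_n | (i < (s^-1)%g i)%N && (i < s i)%N].
Definition Cdrise : {set 'I_n} := [set i : 'I_n | ((s^-1)%g i < i)%N && (i < s i)%N].
Definition Cdfall : {set 'I_n} := [set i : 'I_n | (i < (s^-1)%g i)%N && (s i < i)%N].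
Definition Fix : {set 'I_n} := [set i : 'I_n | s i == i].

Definition cyc : nat := #|porbits s|.

Definition ucross j : nat :=
  #|[set t : 'I_n * 'I_n * 'I_n | let: (i, k, l) := t in
     [&& (i < j)%N, (j < k)%N, (k < l)%N, k == s i & l == s j]]|.

Definition unest j : nat :=
  #|[set t : 'I_n * 'I_n * 'I_n | let: (i, k, l) := t in
     [&& (i < j)%N, (j < k)%N, (k < l)%N, k == s j & l == s i]]|.

Definition lcross k : nat :=
  #|[set t : 'I_n * 'I_n * 'I_n | let: (i, j, l) := t in
     [&& (i < j)%N, (j < k)%N, (k < l)%N, i == s k & j == s l]]|.

Definition lnest k : nat :=
  #|[set t : 'I_n * 'I_n * 'I_n | let: (i, j, l) := t in
     [&& (i < j)%N, (j < k)%N, (k < l)%N, i == s l & j == s k]]|.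

Definition psnest i : nat := #|[set j : 'I_n | (j < i)%N && (i < s j)%N]|.

End CyclicStatistics.

Section Polynomials.
Variables (R : comNzRingType) (a : nat -> R) (b c d : nat -> nat -> R).
Variables (e : nat -> R) (lam : R).

Definition Qhat (n : nat) : R :=
  \sum_(s : 'S_n) lam ^+ cyc s
    * (\prod_(i in Cval s) a (ucross s i + unest s i)%N)
    * (\prod_(i in Cpeak s) b (lcross s i) (lnest s i))
    * (\prod_(i in Cdfall s) c (lcross s i) (lnest s i))
    * (\prod_(i in Cdrise s) d (ucross s i) (unest s i))
    * (\prod_(i in Fix s) e (psnest s i)).

(* For n = 0 both sums are empty, so that gamma 0 = lam * e 0. *)
Definition gamma (n : nat) : R :=
  \sum_(xi < n) c (n - 1 - xi)%N xi + \sum_(xi < n) d (n - 1 - xi)%N xi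
  + lam * e n.

(* Only the values for n >= 1 are meaningful. *)
Definition beta (n : nat) : R :=
  (lam + n%:R - 1) * a (n - 1)%N * \sum_(xi < n) b (n - 1 - xi)%N xi.

End Polynomials.

(* A formal power series in t is its sequence of coefficients. *)
Definition fps (R : Type) := nat -> R.

Section PowerSeries.
Variable R : comNzRingType.
Implicit Types f g u : fps R.

Definition fps_one : fps R := fun n => (n == 0)%:R.

Definition fps_monom (x : R) (m : nat) : fps R :=
  fun n => if n == m then x else 0.

Definition fps_add f g : fps R := fun n => f n + g n.

Definition fps_sub f g : fps R := fun n => f n - g n.

Definition fps_mul f g : fps R := fun n => \sum_(i < n.+1) f i * g (n - i)%N.

Definition fps_exp f (k : nat) : fps R := iter k (fps_mul f) fps_one.

(* 1 / (1 - u) = \sum_k u ^ k for u with zero constant term: the powers with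
   k > n do not contribute to the coefficient of t ^ n. *)
Definition fps_geom u : fps R := fun n => \sum_(k < n.+1) fps_exp u k n.

Lemma fps_exp_small u k n : u 0%N = 0 -> (n < k)%N -> fps_exp u k n = 0.
Proof.
move=> u0; elim: k n => [//|k IHk] n ltnk; rewrite /fps_exp iterS /fps_mul.
apply: big1 => -[[|i] /= lti] _; first by rewrite u0 mul0r.
rewrite [X in _ * X](IHk (n - i.+1)%N) ?mulr0 //.
by case: n ltnk lti => // n ltnk _; rewrite subSS (leq_ltn_trans (leq_subr _ _)).
Qed.

Lemma fps_geomP u n :
  u 0%N = 0 -> fps_mul (fps_sub fps_one u) (fps_geom u) n = fps_one n.
Proof.
move=> u0.
have mul1 g : fps_mul fps_one g n = g n.
  rewrite /fps_mul big_ord_recl subn0 mul1r big1 ?addr0 // => i _.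
  by rewrite mul0r.
have -> : fps_mul (fps_sub fps_one u) (fps_geom u) n
          = fps_geom u n - fps_mul u (fps_geom u) n.
  rewrite -[in RHS]mul1 /fps_mul -sumrB; apply: eq_bigr => i _.
  by rewrite mulrBl.
rewrite {1}/fps_geom big_ord_recl -[RHS]addr0 -addrA; congr (_ + _).
apply/eqP; rewrite subr_eq0 /fps_mul; apply/eqP.
under eq_bigr do rewrite /fps_exp iterS -/(fps_exp _ _) /fps_mul.
rewrite exchange_big /=; apply: eq_bigr => -[[|i] /= lti] _.
  by rewrite u0 mul0r big1 // => k _; rewrite mul0r.
rewrite -mulr_sumr /fps_geom; congr (_ * _).
have le : ((n - i.+1).+1 <= n)%N by case: n lti {mul1} => // n _; rewrite subSS ltnS leq_subr.
rewrite (big_ord_widen n (fun k => fps_exp u k (n - i.+1)%N) le).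
rewrite [RHS]big_mkcond /=; apply: eq_bigr => k _.
by case: ltnP => // ltk; rewrite fps_exp_small.
Qed.

(* The finite continued fraction
     1 / (1 - g_k t - b_(k+1) t^2 / (... / (1 - g_(k+m) t))). *)
Fixpoint jfrac_tail (g b : nat -> R) (k m : nat) : fps R :=
  match m with
  | 0 => fps_geom (fps_monom (g k) 1)
  | m'.+1 =>
      fps_geom (fps_add (fps_monom (g k) 1)
        (fps_mul (fps_monom (b k.+1) 2) (jfrac_tail g b k.+1 m')))
  end.

Definition jfrac_convergent (g b : nat -> R) (m : nat) : fps R :=
  jfrac_tail g b 0 m.

(* Convergence of formal power series: each coefficient is eventually
   constant. *)
Definition fps_cvg (F : nat -> fps R) f : Prop :=
  forall n, exists N, forall m, (N <= m)%N -> F m n = f n.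

(* f = 1 / (1 - g_0 t - b_1 t^2 / (1 - g_1 t - b_2 t^2 / (1 - ...))). *)
Definition is_jfraction (g b : nat -> R) f : Prop :=
  fps_cvg (jfrac_convergent g b) f.

End PowerSeries.

(* Main.v *)
(* Let F(N, h) be the sum over the permutations s of N letters sending the first
   h letters to letters >= h (so that these are cycle valleys), with the weight
   lam ^ cyc s times the weights of the letters >= h only. Then F(n, 0) is
   Qhat n, and F(h, h) = 0 for h > 0. Let x be the letter of index h, the
   smallest one that carries a weight. If x is a cycle valley, its weight is
   a_h and s is also a permutation counted by F(N + 1, h + 1). Otherwise
   short-circuit a letter: x if x is a fixed point or a cycle double rise, s x
   if it is a cycle double fall, and x then s x if it is a cycle peak. This
   changes neither the statistics of the letters above x nor the cycles, except
   when the removed letter is a fixed point, and summing over the places where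
   it may be reinserted gives
     F(N + 1, h) = a_h F(N + 1, h + 1) + gamma_h F(N, h)
                   + (lam + h - 1) (\sum_xi b_(h - 1 - xi, xi)) F(N - 1, h - 1).
   So W(m, h) = F(h + m, h) counts weighted walks from height h to 0, whose
   returns to 0 are enumerated by the J-fraction. *)
Require Import Defs.
From mathcomp Require Import all_boot all_order all_algebra all_fingroup.
From mathcomp Require Import zify ring.

Set Implicit Arguments.
Unset Strict Implicit.
Unset Printing Implicit Defensive.

Import GRing.Theory.
Local Open Scope ring_scope.

(** * Weighted walks and J-fractions *)

Section PowerSeries.
Variable R : comNzRingType.
Implicit Types (f g u : fps R) (n m k : nat).

(** Coefficients up to N only see truncations, so the ring laws of polynomials pass to [fps_mul]. *)
Lemma fps_mul_poly f g n N : (n <= N)%N ->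
  fps_mul f g n = ((\poly_(i < N.+1) f i) * (\poly_(i < N.+1) g i))`_n.
Proof.
move=> leN; rewrite coefM; apply: eq_bigr => i _.
have ltin := ltn_ord i.
by rewrite !coef_poly (leq_trans ltin) // (leq_ltn_trans (leq_subr _ _)).
Qed.

Lemma fps_mulC f g n : fps_mul f g n = fps_mul g f n.
Proof. by rewrite !(fps_mul_poly _ _ (leqnn n)) mulrC. Qed.

Lemma fps_mulA f g u n :
  fps_mul f (fps_mul g u) n = fps_mul (fps_mul f g) u n.
Proof.
have -> : fps_mul f (fps_mul g u) n =
  ((\poly_(i < n.+1) f i) * ((\poly_(i < n.+1) g i) * (\poly_(i < n.+1) u i)))`_n.
  rewrite coefM; apply: eq_bigr => i _; rewrite coef_poly ltn_ord.
  by rewrite (@fps_mul_poly g u _ n) // leq_subr.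
rewrite mulrA coefM; apply: eq_bigr => i _.
rewrite coef_poly ltnS leq_subr.
by rewrite (@fps_mul_poly f g _ n) // -ltnS ltn_ord.
Qed.

Lemma eq_fps_mul f f' g g' n :
    (forall i, (i <= n)%N -> f i = f' i) -> (forall i, (i <= n)%N -> g i = g' i) ->
  fps_mul f g n = fps_mul f' g' n.
Proof.
move=> ef eg; apply: eq_bigr => i _.
by rewrite ef ?eg ?leq_subr // -ltnS ltn_ord.
Qed.

Lemma fps_mulDl f f' g n :
  fps_mul (fps_add f f') g n = fps_mul f g n + fps_mul f' g n.
Proof. by rewrite -big_split; apply: eq_bigr => i _; rewrite mulrDl. Qed.

Lemma fps_mul1 f n : fps_mul (@fps_one R) f n = f n.
Proof.
rewrite /fps_mul big_ord_recl subn0 mul1r big1 ?addr0 // => i _.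
by rewrite mul0r.
Qed.

Lemma fps_monom_mul (x : R) m f n :
  fps_mul (fps_monom x m) f n = if (m <= n)%N then x * f (n - m)%N else 0.
Proof.
rewrite /fps_mul /fps_monom; case: leqP => lemn.
  rewrite (bigD1 (Ordinal (lemn : (m < n.+1)%N))) //= eqxx big1 ?addr0 // => i.
  by rewrite -val_eqE /= => /negPf ->; rewrite mul0r.
rewrite big1 // => i _; rewrite ifF ?mul0r //; have := ltn_ord i; lia.
Qed.

Lemma fps_geom_rec u n :
  u 0%N = 0 -> fps_geom u n = fps_one R n + fps_mul u (fps_geom u) n.
Proof.
move=> u0; rewrite -(fps_geomP n u0).
rewrite -{1}[fps_geom u n]fps_mul1 -big_split; apply: eq_bigr => i _ /=.
by rewrite -mulrDl /fps_sub subrK.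
Qed.

Variables (g b : nat -> R).

Lemma jfrac_tail0 k m : jfrac_tail g b k m 0 = 1.
Proof.
case: m => [|m] /=; rewrite /fps_geom big_ord_recl big_ord0 addr0 //.
Qed.

(** Coefficient n+1 of D = 1 + (g_k t + b_(k+1) t^2 D') D times f, where D' is the next tail. The
    factor f is free so that the rule applies to products with walk series. *)
Lemma jfrac_tailS k m f n :
  fps_mul (jfrac_tail g b k m.+1) f n.+1 =
    f n.+1 + g k * fps_mul (jfrac_tail g b k m.+1) f n
    + (if n is n'.+1 then
         b k.+1 * fps_mul (jfrac_tail g b k.+1 m)
                          (fps_mul (jfrac_tail g b k m.+1) f) n'
       else 0).
Proof.
set u := fps_add (fps_monom (g k) 1)
           (fps_mul (fps_monom (b k.+1) 2) (jfrac_tail g b k.+1 m)).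
have u0 : u 0%N = 0 by rewrite /u /fps_add fps_monom_mul /fps_monom addr0.
have D : jfrac_tail g b k m.+1 = fps_geom u by [].
rewrite {1}D.
rewrite (@eq_fps_mul _ (fps_add (fps_one R) (fps_mul u (fps_geom u))) _ f) //;
  last by move=> i _; rewrite fps_geom_rec.
rewrite fps_mulDl fps_mul1 -addrA; congr (_ + _).
rewrite -fps_mulA fps_mulDl fps_monom_mul subn1 -D; congr (_ + _).
rewrite -fps_mulA fps_monom_mul; case: n => [|n] //=.
by rewrite !subSS subn0.
Qed.

End PowerSeries.

(** * First-passage decomposition of weighted walks *)

Section Motzkin.
Variables (R : comNzRingType) (A B g : nat -> R) (W : nat -> nat -> R).
Hypothesis W0 : forall h, W 0 h = (h == 0)%:R.
Hypothesis WS : forall m h, W m.+1 h =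
  A h * W m h.+1 + g h * W m h + (if h is h'.+1 then B h * W m h' else 0).

Variable bt : nat -> R.
Hypothesis btS : forall h, bt h.+1 = A h * B h.+1.

(* By first passages, a walk from height h to 0 splits into a walk that stays at
   height >= h and returns to h, a step down, and a walk from h - 1 to 0. *)
Fixpoint height_gf (M h : nat) : fps R :=
  let D := jfrac_tail g bt h (M - h) in
  if h is h'.+1 then fps_mul (fps_monom (B h) 1) (fps_mul D (height_gf M h'))
  else D.

Lemma height_gf0 M h : height_gf M h 0 = (h == 0)%:R.
Proof.
by case: h => [|h] /=; rewrite ?jfrac_tail0 // fps_monom_mul.
Qed.

Lemma height_gfS M h n : height_gf M h.+1 n.+1 =
  B h.+1 * fps_mul (jfrac_tail g bt h.+1 (M - h.+1)) (height_gf M h) n.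
Proof. by rewrite /= fps_monom_mul subn1. Qed.

(** Write G_h for [height_gf M h] and D_h for the tail at h. For h > 0, multiplying D_h = 1 + g_h t
    D_h + A_h B_(h+1) t^2 D_(h+1) D_h by B_h t G_(h-1) gives G_h = B_h t G_(h-1) + g_h t G_h + A_h t
    G_(h+1). The bound h < M lets the tail at h unfold once. *)
Lemma height_gf_rec M h m : (h < M)%N ->
  height_gf M h m.+1 = A h * height_gf M h.+1 m + g h * height_gf M h m
    + (if h is h'.+1 then B h * height_gf M h' m else 0).
Proof.
move=> ltM; have tail: (M - h)%N = (M - h.+1).+1 by lia.
case: h ltM tail => [|h] ltM tail.
  have D1 i : fps_mul (jfrac_tail g bt 0 (M - 1).+1) (fps_one R) i
      = height_gf M 0 i.
    by rewrite fps_mulC fps_mul1 /= tail.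
  rewrite -D1 jfrac_tailS D1 add0r addr0 addrC; congr (_ + _).
  case: m => [|m]; first by rewrite height_gf0 mulr0.
  rewrite height_gfS mulrA btS; congr (_ * _).
  by apply: eq_fps_mul => // i _; rewrite D1.
rewrite height_gfS; case: m => [|m].
  rewrite !height_gf0 !mulr0 !add0r; congr (_ * _).
  by rewrite /fps_mul big_ord1 jfrac_tail0 mul1r subn0 height_gf0.
rewrite !height_gfS tail jfrac_tailS.
set X := fps_mul _ (height_gf M h).
have -> : fps_mul (jfrac_tail g bt h.+2 (M - h.+2)) (height_gf M h.+1) m =
    if m is m'.+1 then
      B h.+1 * fps_mul (jfrac_tail g bt h.+2 (M - h.+2)) X m' else 0.
  rewrite /= tail fps_mulA.
  rewrite (@eq_fps_mul _ _ (fps_mul (fps_monom (B h.+1) 1)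
     (jfrac_tail g bt h.+2 (M - h.+2))) _ X) //; last first.
    by move=> i _; rewrite fps_mulC.
  rewrite -fps_mulA fps_monom_mul; case: m => [|m] //.
  by rewrite subn1.
by case: m => [|m]; rewrite ?btS; ring.
Qed.

(** A walk of m steps from height h never exceeds m + h, so truncation at M is not felt. *)
Lemma height_gfE M m h : (m + h <= M)%N -> W m h = height_gf M h m.
Proof.
elim: m h => [|m IH] h leM; first by rewrite W0 height_gf0.
rewrite WS height_gf_rec ?IH; try lia.
by case: h leM => // h leM; rewrite IH //; lia.
Qed.

Lemma jfraction_walks : is_jfraction g bt (fun n => W n 0).
Proof.
by move=> n; exists n => m lenm; rewrite (@height_gfE m) ?addn0 //= subn0.
Qed.
End Motzkin.

(** * Inserting a letter in a cycle *)

Section Insertion.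
Variable N : nat.
Implicit Types (x p : 'I_N.+1) (s : 'S_N) (i j k v : 'I_N).

(* Inserts the letter x right after p in its cycle, or as a fixed point if
   p = x. *)
Definition ins x p s : 'S_N.+1 := (tperm x p * lift_perm x x s)%g.

Lemma ins_at x p s : ins x p s p = x.
Proof. by rewrite permM tpermR lift_perm_id. Qed.

Lemma ins_out x s k : ins x (lift x k) s x = lift x (s k).
Proof. by rewrite permM tpermL lift_perm_lift. Qed.

Lemma ins_lift x p s k : lift x k != p -> ins x p s (lift x k) = lift x (s k).
Proof.
by move=> kp; rewrite permM tpermD ?lift_perm_lift ?neq_lift // eq_sym.
Qed.

Lemma ins_inv x p s v :
  ((ins x p s)^-1)%g (lift x v) = tperm x p (lift x ((s^-1)%g v)).
Proof. by rewrite invMg tpermV permM lift_permV lift_perm_lift. Qed.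

Lemma ltn_lift x i j : (lift x i < lift x j)%N = (i < j)%N.
Proof. by rewrite !ltnNge /= leq_bump2. Qed.

Lemma tperm_ltn (T : nat) (x p u : 'I_T) (k : nat) : (x < k)%N -> (p < k)%N ->
  (tperm x p u < k)%N = (u < k)%N.
Proof. by move=> xk pk; case: tpermP => // ->; rewrite xk pk. Qed.

Lemma tperm_gtn (T : nat) (x p u : 'I_T) (k : nat) : (x < k)%N -> (p < k)%N ->
  (k < tperm x p u)%N = (k < u)%N.
Proof. by move=> xk pk; case: tpermP => // ->; lia. Qed.

Lemma card_lift x (A : {set 'I_N.+1}) : x \notin A ->
  #|A| = #|[set v | lift x v \in A]|.
Proof.
move=> xA; rewrite -(card_imset _ (@lift_inj _ x)); apply: eq_card => u.
apply/idP/imsetP => [uA | [v + ->]]; last by rewrite inE.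
case: (unliftP x u) => [v uv | ux]; last by rewrite -ux uA in xA.
by exists v; rewrite // inE -uv.
Qed.

(** The map s -> [ins x p s] is a bijection onto the permutations with t p = x, inverted by
    [del]. *)
Lemma sum_ins (R : nmodType) x p (P : pred 'S_N.+1) (G : 'S_N.+1 -> R) :
  \sum_(t | P t && (t p == x)) G t = \sum_(s | P (ins x p s)) G (ins x p s).
Proof.
pose del (t : 'S_N.+1) k := odflt k (unlift x (t (tperm x p (lift x k)))).
have delK (t : 'S_N.+1) k : t p = x -> lift x (del t k) = t (tperm x p (lift x k)).
  move=> tp; rewrite /del; case: unliftP => [v -> //|].
  rewrite -[X in _ = X -> _]tp => /perm_inj /(congr1 (tperm x p)).
  by rewrite tpermK tpermR => /eqP; rewrite eq_sym (negPf (neq_lift _ _)).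
have del_inj (t : 'S_N.+1) : t p = x -> injective (del t).
  by move=> tp i j /(congr1 (lift x)); rewrite !delK // => /perm_inj/perm_inj/lift_inj.
pose f (t : 'S_N.+1) := if (t p =P x) is ReflectT tp then perm (del_inj t tp) else 1%g.
rewrite (reindex_onto (ins x p) f) /=.
  apply: eq_bigl => s; rewrite ins_at eqxx andbT.
  suff -> : f (ins x p s) = s by rewrite eqxx andbT.
  apply/permP => k; rewrite /f; case: eqP => [tp|]; last by rewrite ins_at.
  apply: (@lift_inj _ x); rewrite permE delK // permM tpermK lift_perm_lift //.
move=> t /andP[_ /eqP tp]; apply/permP => u.
rewrite permM; set u' := tperm x p u.
have -> : u = tperm x p u' by rewrite tpermK.
case: (unliftP x u') => [v ->|->]; last by rewrite lift_perm_id tpermL.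
rewrite lift_perm_lift /f; case: eqP => // tp'.
by rewrite permE delK.
Qed.

Lemma porbit_lift_perm x s i j :
  (lift x i \in porbit (lift_perm x x s) (lift x j)) = (i \in porbit s j).
Proof.
have E n : (lift_perm x x s ^+ n)%g (lift x j) = lift x ((s ^+ n)%g j).
  by elim: n => [|n IH]; rewrite ?expg0 ?perm1 // !expgSr !permM IH lift_perm_lift.
apply/porbitP/porbitP => -[n].
  by rewrite E => /lift_inj ->; exists n.
by move=> ->; exists n; rewrite E.
Qed.

Lemma porbit_lift_perm_id x s : porbit (lift_perm x x s) x = [set x].
Proof.
apply/setP => u; rewrite inE; apply/porbitP/eqP => [[n ->]|->]; last first.
  by exists 0%N; rewrite expg0 perm1.
by elim: n => [|n IH]; rewrite ?expg0 ?perm1 // expgSr permM IH lift_perm_id.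
Qed.

Lemma cyc_lift_perm x s : cyc (lift_perm x x s) = (cyc s).+1.
Proof.
rewrite /cyc.
pose L := fun A : {set 'I_N} => lift x @: A.
have L_inj : injective L by apply: imset_inj; apply: lift_inj.
have porbitL j : porbit (lift_perm x x s) (lift x j) = L (porbit s j).
  apply/setP => u; apply/idP/imsetP => [|[i + ->]]; last by rewrite porbit_lift_perm.
  case: (unliftP x u) => [i ->|->]; first by rewrite porbit_lift_perm; exists i.
  by rewrite porbit_sym porbit_lift_perm_id inE eq_sym (negPf (neq_lift _ _)).
have -> : porbits (lift_perm x x s) = [set x] |: L @: porbits s.
  apply/setP => O; rewrite !inE; apply/imsetP/idP => [[u _ ->]|].
    case: (unliftP x u) => [j ->|->]; last by rewrite porbit_lift_perm_id eqxx.
    by rewrite porbitL !imset_f ?orbT.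
  case/orP => [/eqP ->|/imsetP[_ /imsetP[j _ ->] ->]].
    by exists x; rewrite ?porbit_lift_perm_id.
  by exists (lift x j); rewrite ?porbitL.
rewrite cardsU1 card_imset // -[RHS]add1n; congr (_ + _)%N; apply/eqP.
rewrite eqb1; apply/imsetP => -[A _] /setP /(_ x).
rewrite inE eqxx => /esym/imsetP[j _] /eqP.
by rewrite (negPf (neq_lift _ _)).
Qed.

(** The transposition merges the fixed point x of [lift_perm x x s] into the cycle of p, unless p =
    x. *)
Lemma cyc_ins x p s : cyc (ins x p s) = (cyc s + (p == x))%N.
Proof.
have := porbits_mul_tperm (lift_perm x x s) x p.
rewrite porbit_sym porbit_lift_perm_id inE [x == p]eq_sym /= => E.
have {}E : (cyc (ins x p s) + (p != x).*2 = cyc (lift_perm x x s) + (p != x))%N by [].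
by move: E; rewrite cyc_lift_perm; case: (p == x) => /=; lia.
Qed.

End Insertion.

(** * Letter weights *)

Lemma card_ord_lt n h : (h <= n)%N -> #|[set i : 'I_n | (i < h)%N]| = h.
Proof.
by move=> hn; rewrite -sum1dep_card (big_ord_narrow hn) sum1_card card_ord.
Qed.

Section Statistics.
Variables (n : nat) (s : 'S_n).
Implicit Types i j k v : 'I_n.

(* A triple counted by a crossing or nesting statistic is determined by one of
   its entries v, a value taken at s^-1 v; for nestings this is correct only when
   s k < k (lnestv) or j < s j (unestv). *)
Definition lcrossv k := #|[set v : 'I_n | (s k < v < k)%N && (k < (s^-1)%g v)%N]|.
Definition lnestv k := #|[set v : 'I_n | (v < s k)%N && (k < (s^-1)%g v)%N]|.
Definition ucrossv j := #|[set v : 'I_n | (j < v < s j)%N && ((s^-1)%g v < j)%N]|.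
Definition unestv j := #|[set v : 'I_n | (s j < v)%N && ((s^-1)%g v < j)%N]|.
Definition psnestv i := #|[set v : 'I_n | (i < v)%N && ((s^-1)%g v < i)%N]|.

Lemma lcrossE k : lcross s k = lcrossv k.
Proof.
have inj : injective (fun v => (s k, v, (s^-1)%g v)) by move=> v w [].
rewrite /lcrossv -(card_imset _ inj); apply: eq_card => -[[i j] l]; rewrite !inE.
apply/idP/imsetP => [/and5P[ij jk kl /eqP ik /eqP jl]|[v]].
  by exists j; [rewrite inE -ik ij jk jl permK | rewrite ik jl permK].
by rewrite inE => /andP[/andP[ij jk] kl] [-> -> ->]; rewrite permKV ij jk kl !eqxx.
Qed.

Lemma lnestE k : (s k < k)%N -> lnest s k = lnestv k.
Proof.
move=> sk; have inj : injective (fun v => (v, s k, (s^-1)%g v)) by move=> v w [].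
rewrite /lnestv -(card_imset _ inj); apply: eq_card => -[[i j] l]; rewrite !inE.
apply/idP/imsetP => [/and5P[ij jk kl /eqP ik /eqP jl]|[v]].
  by exists i; [rewrite inE -jl ij ik permK | rewrite ik jl permK].
by rewrite inE => /andP[ij kl] [-> -> ->]; rewrite permKV ij sk kl !eqxx.
Qed.

Lemma ucrossE j : ucross s j = ucrossv j.
Proof.
have inj : injective (fun v => ((s^-1)%g v, v, s j)) by move=> v w [].
rewrite /ucrossv -(card_imset _ inj); apply: eq_card => -[[i k] l]; rewrite !inE.
apply/idP/imsetP => [/and5P[ij jk kl /eqP ki /eqP lj]|[v]].
  by exists k; [rewrite inE -lj jk kl ki permK | rewrite lj ki permK].
by rewrite inE => /andP[/andP[jk kl] ij] [-> -> ->]; rewrite permKV ij jk kl !eqxx.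
Qed.

Lemma unestE j : (j < s j)%N -> unest s j = unestv j.
Proof.
move=> sj; have inj : injective (fun v => ((s^-1)%g v, s j, v)) by move=> v w [].
rewrite /unestv -(card_imset _ inj); apply: eq_card => -[[i k] l]; rewrite !inE.
apply/idP/imsetP => [/and5P[ij jk kl /eqP ki /eqP lj]|[v]].
  by exists l; [rewrite inE -ki kl lj permK | rewrite lj ki permK].
by rewrite inE => /andP[kl ij] [-> -> ->]; rewrite permKV ij sj kl !eqxx.
Qed.

Lemma psnestE i : psnest s i = psnestv i.
Proof.
rewrite /psnest -(card_imset _ (@perm_inj _ s)); apply: eq_card => v; rewrite !inE.
apply/imsetP/andP => [[j + ->]|[iv vi]].
  by rewrite inE permK andbC => /andP.
by exists ((s^-1)%g v); rewrite ?inE permKV // vi.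
Qed.

Lemma card_perm_lt h : (h <= n)%N -> #|[set v | ((s^-1)%g v < h)%N]| = h.
Proof.
move=> hn; have -> : [set v | ((s^-1)%g v < h)%N] = (s^-1)%g @^-1: [set i : 'I_n | (i < h)%N].
  by apply/setP => v; rewrite !inE.
by rewrite card_preimset ?card_ord_lt //; apply: perm_inj.
Qed.

End Statistics.

(** * Summation over ranks *)

Section Rank.
Variables (I : finType) (D : {set I}) (f : I -> nat).
Hypothesis f_inj : {in D &, injective f}.

Let up p := #|[set i in D | (f p < f i)%N]|.
Let dn p := #|[set i in D | (f i < f p)%N]|.

(** Since f is injective on D, [up] is a bijection from D onto 0, ..., #|D| - 1, and the two counts
    add up to #|D| - 1. *)
Lemma sum_rank (R : nmodType) (G : nat -> nat -> R) :
  \sum_(p in D) G #|[set i in D | (f i < f p)%N]| #|[set i in D | (f p < f i)%N]|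
  = \sum_(xi < #|D|) G (#|D| - 1 - xi)%N xi.
Proof.
have cardD p : p \in D -> (dn p + up p = #|D| - 1)%N.
  move=> pD; rewrite (cardsD1 p) pD addKn -cardsUI.
  rewrite [X in (_ + X)%N]eq_card0 ?addn0; last first.
    by move=> i; rewrite !inE; case: ltngtP; rewrite ?andbF.
  apply: eq_card => i; rewrite !inE -andb_orr andbC; case iD: (i \in D); rewrite ?andbF //.
  by rewrite !andbT -neq_ltn; congr (~~ _); apply/eqP/eqP => [/f_inj->|->].
have up_lt p : p \in D -> (up p < #|D|)%N.
  by move=> pD; have := cardD _ pD; have : (0 < #|D|)%N by [apply/card_gt0P; exists p]; lia.
have up_inj : {in D &, injective up}.
  suff mono p q : p \in D -> q \in D -> (f p < f q)%N -> (up q < up p)%N.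
    move=> p q pD qD; case: (ltngtP (f p) (f q)) => [pq|pq|/f_inj-> //] eq_up.
      by have := mono p q pD qD pq; rewrite eq_up ltnn.
    by have := mono q p qD pD pq; rewrite eq_up ltnn.
  move=> pD qD pq; apply: proper_card; apply/properP; split.
    by apply/subsetP => i; rewrite !inE => /andP[-> /(ltn_trans pq)].
  by exists q; rewrite !inE ?qD ?pq ?ltnn.
case: (posnP #|D|) => [/eqP D0|Dgt0].
  move: D0; rewrite cards_eq0 => /eqP ->.
  by rewrite cards0 big_ord0 big_set0.
case ED : #|D| Dgt0 => [//|m] _.
pose r p : 'I_m.+1 := inord (up p).
have rE p : p \in D -> r p = up p :> nat.
  by move=> pD; rewrite inordK // -ED up_lt.
have r_inj : {in D &, injective r}.
  by move=> p q pD qD /(congr1 val) /=; rewrite !rE //; apply: up_inj.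
have imr : r @: D = [set: 'I_m.+1].
  by apply/eqP; rewrite eqEcard subsetT cardsT card_ord card_in_imset // ED /=.
transitivity (\sum_(xi in [set: 'I_m.+1]) G (m.+1 - 1 - xi)%N xi); last first.
  by apply: eq_bigl => xi; rewrite inE.
rewrite -imr big_imset //; apply: eq_bigr => p pD /=.
by rewrite rE //; have := cardD _ pD; rewrite ED => <-; rewrite addnK.
Qed.
End Rank.

Section Weights.
Variables (R : comNzRingType) (a : nat -> R) (b c d : nat -> nat -> R).
Variables (e : nat -> R) (lam : R).

(** One factor per letter replaces the five products. Testing fixed points first makes the strict
    comparisons separate the other types, and [lnestv] and [unestv] occur only where they are
    correct. *)
Definition wt n (s : 'S_n) (i : 'I_n) : R :=
  if s i == i then e (psnestv s i)
  else if ((s^-1)%g i < i)%N then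
    if (s i < i)%N then b (lcrossv s i) (lnestv s i) else d (ucrossv s i) (unestv s i)
  else
    if (s i < i)%N then c (lcrossv s i) (lnestv s i) else a (ucrossv s i + unestv s i)%N.

Lemma Qhat_wt n : Qhat a b c d e lam n =
  \sum_(s : 'S_n) lam ^+ cyc s * \prod_i wt s i.
Proof.
apply: eq_bigr => s _; rewrite -!mulrA; congr (_ * _).
rewrite big_mkcond [X in _ * (X * _)]big_mkcond [X in _ * (_ * (X * _))]big_mkcond.
rewrite [X in _ * (_ * (_ * (X * _)))]big_mkcond.
rewrite [X in _ * (_ * (_ * (_ * X)))]big_mkcond -!big_split /=.
apply: eq_bigr => i _; rewrite !inE /wt.
have Vfix : ((s^-1)%g i == i) = (s i == i).
  by rewrite -(inj_eq (@perm_inj _ s)) permKV eq_sym.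
rewrite ucrossE lcrossE psnestE; move: Vfix; rewrite -!val_eqE.
case: (ltngtP (s i) i) (ltngtP ((s^-1)%g i) i) => [si|si|si] [] //= _ _;
  by rewrite ?mul1r ?mulr1 ?lnestE ?unestE.
Qed.

(** Insertion relabels values in order and alters preimages only by exchanging x and p, both below
    [lift x k], so comparisons with that letter survive. The extra value x is counted by none of the
    statistics involved. *)
Lemma wt_ins N (x p : 'I_N.+1) (s : 'S_N) (k : 'I_N) : (x <= k)%N -> (p <= k)%N ->
  wt (ins x p s) (lift x k) = wt s k.
Proof.
move=> xk pk; set t := ins x p s.
have xk' : (x < lift x k)%N by rewrite /= /bump xk; lia.
have pk' : (p < lift x k)%N by rewrite /= /bump xk; lia.
have tk : t (lift x k) = lift x (s k).
  by apply: ins_lift; rewrite -val_eqE neq_ltn pk' orbT.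
have Vlt v : ((t^-1)%g (lift x v) < lift x k)%N = ((s^-1)%g v < k)%N.
  by rewrite ins_inv tperm_ltn // ltn_lift.
have Vgt v : (lift x k < (t^-1)%g (lift x v))%N = (k < (s^-1)%g v)%N.
  by rewrite ins_inv tperm_gtn // ltn_lift.
have Vx : (t^-1)%g x = p by rewrite -(ins_at x p s) permK.
have kx : (lift x k < x)%N = false by rewrite ltnNge ltnW.
have kp : (lift x k < p)%N = false by rewrite ltnNge ltnW.
rewrite /wt tk (inj_eq (@lift_inj _ x)) !Vlt !ltn_lift.
have -> : psnestv t (lift x k) = psnestv s k.
  rewrite /psnestv (@card_lift _ x) ?inE ?kx //; apply: eq_card => v.
  by rewrite !inE ltn_lift Vlt.
have -> : lcrossv t (lift x k) = lcrossv s k.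
  rewrite /lcrossv (@card_lift _ x) ?inE ?Vx ?kp ?andbF //; apply: eq_card => v.
  by rewrite !inE tk !ltn_lift Vgt.
have -> : lnestv t (lift x k) = lnestv s k.
  rewrite /lnestv (@card_lift _ x) ?inE ?Vx ?kp ?andbF //; apply: eq_card => v.
  by rewrite !inE tk !ltn_lift Vgt.
have -> : ucrossv t (lift x k) = ucrossv s k.
  rewrite /ucrossv (@card_lift _ x) ?inE ?kx //; apply: eq_card => v.
  by rewrite !inE tk !ltn_lift Vlt.
(* [unestv] occurs in [wt] only for k < s k; then x lies below t (lift x k) and is not counted. *)
rewrite -val_eqE; case: (ltngtP (s k) k) => //= ksk.
have -> // : unestv t (lift x k) = unestv s k.
rewrite /unestv (@card_lift _ x); last first.
  have xsk : (x < lift x (s k))%N by rewrite (ltn_trans xk') // ltn_lift.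
  by rewrite inE tk [(lift x (s k) < x)%N]ltnNge (ltnW xsk).
by apply: eq_card => v; rewrite !inE tk !ltn_lift Vlt.
Qed.

End Weights.

(** * Removing the smallest weighted letter *)

(* Equivalently, the first h letters are cycle valleys. *)
Definition openers h N (s : 'S_N) := [forall i : 'I_N, (i < h)%N ==> (h <= s i)%N].

(* The preimage p of the letter h is exempted, so that the condition does not
   involve h as a value. *)
Definition openers_but N h (p : 'I_N.+1) (t : 'S_N.+1) :=
  [forall i : 'I_N.+1, (i <= h)%N && (i != p) ==> (h < t i)%N].

(** The letters <= h other than p are the [tperm x p (lift x i)] with i < h, and h < lift x v means
    h <= v. *)
Lemma openers_but_ins N (h : nat) (x p : 'I_N.+1) (s : 'S_N) :
  (x <= h)%N -> (p <= h)%N -> openers_but h p (ins x p s) = openers h s.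
Proof.
move=> xh ph; apply/forallP/forallP => H i; apply/implyP.
  move=> ih; have := H (tperm x p (lift x i)).
  rewrite permM tpermK lift_perm_lift -ltnS tperm_ltn // ltnS.
  rewrite (can2_eq (tpermK x p) (tpermK x p)) tpermR (eq_sym _ x) neq_lift.
  by rewrite /= /bump; lia.
case/andP=> ih ip; rewrite permM.
have : tperm x p i != x by rewrite (can2_eq (tpermK x p) (tpermK x p)) tpermL.
have : (tperm x p i < h.+1)%N by rewrite tperm_ltn.
case: (unliftP x (tperm x p i)) => [j ->|->]; last by rewrite eqxx.
by rewrite lift_perm_lift => + _; move: (H j) => /=; rewrite /bump; lia.
Qed.

Lemma big_lift (R : Type) (idx : R) (op : Monoid.com_law idx) N (x : 'I_N.+1)
    (P : pred 'I_N.+1) (G : 'I_N.+1 -> R) : ~~ P x ->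
  \big[op/idx]_(i | P i) G i = \big[op/idx]_(j | P (lift x j)) G (lift x j).
Proof.
move=> /negPf Px; rewrite big_mkcond (bigD1_ord x) //= Px Monoid.mul1m.
by rewrite [RHS]big_mkcond.
Qed.

Section Recursion.
Variables (R : comNzRingType) (a : nat -> R) (b c d : nat -> nat -> R).
Variables (e : nat -> R) (lam : R).

Notation wt := (wt a b c d e).

(** This is F(N, h). *)
Definition Qpart N h : R :=
  \sum_(s : 'S_N | openers h s) lam ^+ cyc s * \prod_(i : 'I_N | (h <= i)%N) wt s i.

Lemma Qpart0 n : Qpart n 0 = Qhat a b c d e lam n.
Proof. by rewrite Qhat_wt; apply: eq_bigl => s; apply/forallP. Qed.

Lemma Qpart_diag h : Qpart h h = (h == 0%N)%:R.
Proof.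
case: h => [|h]; last first.
  rewrite /Qpart big_pred0 // => s; apply/forallP => /(_ ord0) /=.
  by rewrite leqNgt ltn_ord.
rewrite Qpart0 Qhat_wt (big_pred1 1%g) => [|s]; last first.
  by rewrite /= eq_sym; apply/esym/eqP/permP => -[].
rewrite big_ord0 mulr1 /cyc; suff -> : porbits (1 : 'S_0) = set0 by rewrite cards0.
by apply/setP => A; rewrite inE; apply/imsetP => -[[]].
Qed.

(** * Contribution of each cyclic type of the letter x *)

Section Letter.
Variables (N : nat) (x : 'I_N.+1).
Implicit Types (t : 'S_N.+1) (s : 'S_N) (i p q : 'I_N.+1).

Definition wt_above t := lam ^+ cyc t * \prod_(i : 'I_N.+1 | (x < i)%N) wt t i.

Lemma wt_above_ins (y : 'I_N.+1) p s : (y <= x)%N -> (p <= x)%N ->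
  wt_above (ins y p s) =
  lam ^+ (p == y) * (lam ^+ cyc s * \prod_(i : 'I_N | (x <= i)%N) wt s i).
Proof.
move=> yx px; rewrite /wt_above cyc_ins addnC exprD -mulrA; congr (_ * (_ * _)).
rewrite (@big_lift _ _ _ _ y) -?leqNgt //.
have lt_lift (i : 'I_N) : (x < lift y i)%N = (x <= i)%N by rewrite /= /bump; lia.
rewrite (eq_bigl _ _ lt_lift); apply: eq_bigr => i xi.
by rewrite wt_ins // (leq_trans _ xi).
Qed.

(** Short-circuiting y = t p leaves a permutation counted by [Qpart N x]. The removed letter y need
    not be the threshold x: it is t x for a double fall, and likewise in the second removal at a
    peak. *)
Lemma sum_wt_above (y : 'I_N.+1) p : (y <= x)%N -> (p <= x)%N ->
  \sum_(t | openers_but x p t && (t p == y)) wt_above t = lam ^+ (p == y) * Qpart N x.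
Proof.
move=> yx px; rewrite sum_ins mulr_sumr.
by apply: eq_big => [s|s _]; rewrite ?openers_but_ins ?wt_above_ins.
Qed.

Lemma openers_le t i : openers x t -> (i < x)%N -> (x <= t i)%N.
Proof. by move/forallP/(_ i)/implyP. Qed.

Lemma openers_leV t i : openers x t -> (i < x)%N -> (x <= (t^-1)%g i)%N.
Proof.
move=> xt ix; rewrite leqNgt; apply/negP => /(openers_le xt).
by rewrite permKV leqNgt ix.
Qed.

Lemma perm_fixV t i : ((t^-1)%g i == i) = (t i == i).
Proof. by rewrite -(inj_eq (@perm_inj _ t)) permKV eq_sym. Qed.

Lemma openers_lt t i : openers x t -> (i < x)%N -> i != (t^-1)%g x -> (x < t i)%N.
Proof.
move=> xt ix ip; rewrite ltn_neqAle openers_le // andbT; apply: contraNneq ip.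
by move=> /val_inj ->; rewrite permK.
Qed.

Lemma openers_fixE t : t x = x -> openers x t = openers_but x x t.
Proof.
move=> tx; apply/idP/forallP => [xt i|H].
  apply/implyP => /andP[ix ixN]; apply: openers_lt => //.
    by rewrite ltn_neqAle ix andbT.
  by have /eqP -> : (t^-1)%g x == x by rewrite perm_fixV tx.
apply/forallP => i; apply/implyP => ix; apply: ltnW; apply: (implyP (H i)).
by rewrite ltnW //= -val_eqE neq_ltn ix.
Qed.

(** Only p takes the value x, so for the other letters below x the bounds >= x and > x agree; the
    clause of [openers_but] at x itself says x < t x. *)
Lemma openers_driseE t p : t p = x -> (p < x)%N ->
  openers x t && (x < t x)%N = openers_but x p t.
Proof.
move=> tp px; have Vx : (t^-1)%g x = p by rewrite -tp permK.
apply/andP/forallP => [[xt tx] i|H].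
  apply/implyP; rewrite leq_eqVlt => /andP[/orP[/eqP/val_inj -> //|ix] ip].
  by rewrite openers_lt // Vx.
split; last by apply: (implyP (H x)); rewrite leqnn -val_eqE neq_ltn px orbT.
apply/forallP => i; apply/implyP => ix; have [->|ip] := eqVneq i p; first by rewrite tp.
by apply: ltnW; apply: (implyP (H i)); rewrite ltnW.
Qed.

(** With x exempted, no letter below x may take the value x; as x is not fixed, its preimage lies
    above it. *)
Lemma openers_dfallE t : (t x < x)%N ->
  openers x t && (x < (t^-1)%g x)%N = openers_but x x t.
Proof.
move=> tx; apply/andP/forallP => [[xt Vx] i|H].
  apply/implyP => /andP[ix ixN]; apply: openers_lt => //.
    by rewrite ltn_neqAle ix andbT.
  by rewrite -val_eqE neq_ltn (leq_ltn_trans ix).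
have lt i : (i < x)%N -> (x < t i)%N.
  by move=> ix; apply: (implyP (H i)); rewrite ltnW //= -val_eqE neq_ltn ix.
split; first by apply/forallP => i; apply/implyP => /lt/ltnW.
rewrite ltnNge leq_eqVlt; apply/negP => /orP[/eqP/val_inj/eqP|/lt].
  by rewrite perm_fixV -val_eqE; move: tx; case: ltngtP.
by rewrite permKV ltnn.
Qed.

(** The letter x is a valley exactly when the first x + 1 letters go above x. Crossings and nestings
    at x then count together the x letters below it. *)
Lemma sum_val :
  \sum_(t | openers x t && (x < t x)%N && (x < (t^-1)%g x)%N) wt t x * wt_above t
  = a x * Qpart N.+1 x.+1.
Proof.
rewrite mulr_sumr; apply: eq_big => [t|t /andP[/andP[xt tx] xVt]].
  apply/andP/forallP => [[/andP[xt tx] xVt] i|H].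
    apply/implyP; rewrite ltnS leq_eqVlt => /orP[/eqP/val_inj -> //|ix].
    rewrite ltn_neqAle openers_le // andbT; apply/eqP => /val_inj E.
    by move: xVt; rewrite {2}E permK ltnNge ltnW.
  have tx i : (i <= x)%N -> (x < t i)%N by move=> ix; apply: (implyP (H i)).
  split; first (apply/andP; split; last exact: tx).
    by apply/forallP => i; apply/implyP => ix; rewrite ltnW // tx // ltnW.
  by rewrite ltnNge; apply/negP => /tx; rewrite permKV ltnn.
have -> : wt t x = a x.
  rewrite /wt -val_eqE; case: ltngtP (tx) => //= _ _; case: ltngtP (xVt) => //= _ _.
  congr a.
  (* The value t x separates the two sets; their union is the set of values taken at letters below
     x. *)
  rewrite /ucrossv /unestv -cardsUI [X in (_ + X)%N]eq_card0 ?addn0; last first.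
    by move=> v; rewrite !inE; case: (ltngtP v (t x)); rewrite ?andbF.
  rewrite -[RHS](card_perm_lt t (ltnW (ltn_ord x))); apply: eq_card => v.
  rewrite !inE -andb_orl andb_idl // => vx.
  have := openers_le xt vx; rewrite permKV => xv.
  have : v != x :> nat.
    by apply: contraTneq vx => /val_inj ->; rewrite -leqNgt ltnW.
  have : v != t x :> nat.
    by apply: contraTneq vx => /val_inj ->; rewrite permK ltnn.
  by lia.
by rewrite /wt_above; congr (_ * _).
Qed.

Lemma sum_fix :
  \sum_(t | openers x t && (t x == x)) wt t x * wt_above t
  = lam * e x * Qpart N x.
Proof.
transitivity (\sum_(t | openers_but x x t && (t x == x)) e x * wt_above t).
  apply: eq_big => [t|t /andP[xt /eqP tx]].
    by case: eqP => [/openers_fixE ->|]; rewrite ?andbF.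
  rewrite /wt tx eqxx; congr (e _ * _); rewrite /psnestv.
  rewrite -[RHS](card_perm_lt t (ltnW (ltn_ord x))); apply: eq_card => v.
  rewrite !inE andb_idl // => vx.
  have := openers_le xt vx; rewrite permKV leq_eqVlt => /orP[/eqP/val_inj xv|//].
  have /eqP Vx : (t^-1)%g x == x by rewrite perm_fixV tx.
  by move: vx; rewrite -xv Vx ltnn.
by rewrite -mulr_sumr sum_wt_above // eqxx expr1 mulrCA mulrA.
Qed.

(** For fixed s, x may be reinserted after any p < x. Its crossings and nestings are then the
    numbers of i < x with s i below and above s p, so by [sum_rank] the sum over p does not depend
    on s. *)
Lemma sum_drise :
  \sum_(t | openers x t && (x < t x)%N && ((t^-1)%g x < x)%N) wt t x * wt_above t
  = (\sum_(xi < x) d (x - 1 - xi)%N xi) * Qpart N x.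
Proof.
rewrite (partition_big (fun t : 'S_N.+1 => (t^-1)%g x) (fun p => p < x)%N) /=; last first.
  by move=> t /andP[].
transitivity (\sum_(p : 'I_N.+1 | (p < x)%N) \sum_(s | openers_but x p (ins x p s))
    wt (ins x p s) x * wt_above (ins x p s)).
  apply: eq_bigr => p px; rewrite -(@sum_ins _ _ x p (openers_but x p)
    (fun t => wt t x * wt_above t)); apply: eq_bigl => t.
  rewrite (can2_eq (permKV t) (permK t)) [x == _]eq_sym.
  case: eqP => [tp|]; rewrite ?andbF // !andbT -(openers_driseE tp px).
  have -> : (t^-1)%g x = p by rewrite -tp permK.
  by rewrite px andbT.
rewrite (@big_lift _ _ _ _ x) ?ltnn //.
have lt_lift (i : 'I_N) : (lift x i < x)%N = (i < x)%N by rewrite /= /bump; lia.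
rewrite (eq_bigl _ _ lt_lift).
pose D := [set i : 'I_N | (i < x)%N].
have cardD : #|D| = x.
  by rewrite card_ord_lt // -ltnS ltn_ord.
transitivity (\sum_(s | openers x s) \sum_(p in D)
   d #|[set i in D | (s i < s p)%N]| #|[set i in D | (s p < s i)%N]|
   * (lam ^+ cyc s * \prod_(i : 'I_N | (x <= i)%N) wt s i)).
  rewrite [RHS]exchange_big; apply: eq_big => [p|p px]; first by rewrite inE.
  have lpx : (lift x p < x)%N by rewrite lt_lift.
  apply: eq_big => s; rewrite openers_but_ins // 1?ltnW // => xs.
  rewrite wt_above_ins // 1?ltnW // [lift x p == x]eq_sym (negPf (neq_lift _ _)) mul1r.
  congr (_ * _).
  set t := ins x (lift x p) s.
  have tx : t x = lift x (s p) by apply: ins_out.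
  have Vx : (t^-1)%g x = lift x p by rewrite -[RHS](permK t) ins_at.
  have xsp : (x <= s p)%N by apply: (implyP (forallP xs p)).
  have xtx : (x < t x)%N by rewrite tx /= /bump; lia.
  (* The value [lift x (s p)] now has preimage x, hence the exclusion of p. *)
  have Vlt v : ((t^-1)%g (lift x v) < x)%N = ((s^-1)%g v < x)%N && ((s^-1)%g v != p).
    rewrite ins_inv; case: tpermP => [/eqP|/lift_inj ->|_ /eqP].
    - by rewrite eq_sym (negPf (neq_lift _ _)).
    - by rewrite ltnn eqxx andbF.
    - by rewrite lt_lift (inj_eq (@lift_inj _ x)) => ->; rewrite andbT.
  rewrite /wt Vx lpx -val_eqE; case: ltngtP (xtx) => //= _ _; congr (d _ _).
    rewrite /ucrossv (@card_lift _ x) ?inE ?ltnn // -(card_preimset _ (@perm_inj _ s)).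
    apply: eq_card => i; rewrite !inE tx Vlt ltn_lift permK.
    case: (ltnP i x) => ix; rewrite ?andbF //=.
    rewrite -(inj_eq (@perm_inj _ s)) -val_eqE /= /bump.
    by move: (implyP (forallP xs i) ix); lia.
  rewrite /unestv (@card_lift _ x) ?inE; last by rewrite ltnNge ltnW.
  rewrite -(card_preimset _ (@perm_inj _ s)).
  apply: eq_card => i; rewrite !inE tx Vlt ltn_lift permK.
  case: (ltnP i x) => ix; rewrite ?andbF ?andbT //=.
  rewrite -(inj_eq (@perm_inj _ s)) -val_eqE /=; lia.
rewrite mulr_sumr; apply: eq_bigr => s xs; rewrite -mulr_suml; congr (_ * _).
rewrite (@sum_rank _ D (fun i : 'I_N => s i)) ?cardD //.
by move=> i j _ _ /val_inj/perm_inj.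
Qed.

(** Values below x are taken at letters >= x, thus above x except for t x. So each value below t x
    gives a nesting, and each value strictly between t x and x a crossing. *)
Lemma lower_stats t : openers x t -> (t x < x)%N ->
  lcrossv t x = (x - 1 - t x)%N /\ lnestv t x = t x.
Proof.
move=> xt tx.
have Vgt (v : 'I_N.+1) : (v < x)%N -> v != t x -> (x < (t^-1)%g v)%N.
  move=> vx vt; rewrite ltn_neqAle openers_leV // andbT.
  by apply: contraNneq vt => /val_inj ->; rewrite permKV.
have lnE : lnestv t x = t x.
  rewrite /lnestv -[RHS](card_ord_lt (ltnW (ltn_ord (t x)))).
  apply: eq_card => v; rewrite !inE andb_idr // => vt.
  by rewrite Vgt -?val_eqE ?neq_ltn ?vt // (ltn_trans vt).
split=> //.
have -> : lcrossv t x = #|[set v : 'I_N.+1 | (v < x)%N] :\: [set v : 'I_N.+1 | (v < (t x).+1)%N]|.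
  apply: eq_card => v; rewrite !inE ltnS -ltnNge; case: (ltnP (t x) v) => //= tv.
  by rewrite andb_idr // => vx; rewrite Vgt // -val_eqE neq_ltn tv orbT.
rewrite cardsDS.
  by rewrite (card_ord_lt (ltnW (ltn_ord x))) (card_ord_lt (ltn_ord (t x))); lia.
by apply/subsetP => v; rewrite !inE ltnS => /leq_ltn_trans -> .
Qed.

(** The removed letter is q = t x. The weight of x depends on q alone, and each q < x yields one
    copy of [Qpart N x]. *)
Lemma sum_dfall :
  \sum_(t | openers x t && (t x < x)%N && (x < (t^-1)%g x)%N) wt t x * wt_above t
  = (\sum_(xi < x) c (x - 1 - xi)%N xi) * Qpart N x.
Proof.
rewrite (partition_big (fun t : 'S_N.+1 => t x) (fun q => q < x)%N) /=; last first.
  by move=> t /andP[/andP[]].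
transitivity (\sum_(q : 'I_N.+1 | (q < x)%N) c (x - 1 - q)%N q * Qpart N x).
  apply: eq_bigr => q qx.
  transitivity (\sum_(t | openers_but x x t && (t x == q)) c (x - 1 - q)%N q * wt_above t).
    apply: eq_big => [t|t /andP[/andP[/andP[xt tx] xVt] /eqP tq]].
      case: (t x =P q) => [tq|]; rewrite ?andbF // -openers_dfallE ?tq // qx.
      by rewrite !andbT.
    have [lcE lnE] := lower_stats xt tx.
    rewrite /wt -val_eqE; case: ltngtP (tx) => //= _ _; case: ltngtP (xVt) => //= _ _.
    by rewrite lcE lnE tq.
  rewrite -mulr_sumr (sum_wt_above (ltnW qx) (leqnn x)).
  by rewrite -val_eqE [(x == q :> nat)]eq_sym ltn_eqF // mul1r.
rewrite -mulr_suml; congr (_ * _).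
by rewrite (big_ord_narrow (ltnW (ltn_ord x))).
Qed.

End Letter.

(** As x > 0, i < x reads i <= x.-1 and a value >= x reads > x.-1. In t the letter p goes to x,
    which is allowed, so p is exempted in s. *)
Lemma openers_peakE N (x : 'I_N.+2) (p : 'I_N.+1) (s : 'S_N.+1) : (p < x)%N ->
  openers x (ins x (lift x p) s) = openers_but x.-1 p s.
Proof.
move=> px; set t := ins x (lift x p) s.
have tE i : i != p -> t (lift x i) = lift x (s i).
  by move=> ip; rewrite /t ins_lift // (inj_eq (@lift_inj _ x)).
apply/forallP/forallP => H i; apply/implyP.
  case/andP=> ix ip; have := H (lift x i); rewrite tE //= /bump; lia.
case: (unliftP x i) => [j ->|->]; last by rewrite ltnn.
have [->|jp] := eqVneq j p; first by rewrite /t ins_at.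
by rewrite tE //= /bump; have := H j; rewrite jp andbT; lia.
Qed.

(** The choice p = q closes a cycle and gives lam, the h - 1 others give 1: hence the factor lam + n
    - 1 of [beta]. *)
Lemma sum_exp_eq n h (q : 'I_n) : (h <= n)%N -> (q < h)%N ->
  \sum_(p < n | (p < h)%N) lam ^+ (p == q) = lam + h%:R - 1.
Proof.
move=> hn qh; transitivity (\sum_(p < n | (p < h)%N) (1 + if p == q then lam - 1 else 0)).
  by apply: eq_bigr => p _; case: eqP => _; rewrite ?addr0 // addrC subrK.
rewrite big_split /= (big_ord_narrow hn) /= sumr_const card_ord.
rewrite -big_mkcondr (big_pred1 q) => [|p /=]; first by rewrite addrCA addrA.
by case: (p =P q) => [->|]; rewrite ?qh ?andbF.
Qed.

(** Let p be the preimage of x and q = t x. First x, then q is removed after p. The weight of x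
    depends on q only, and the second removal yields lam exactly when p = q, that is, when x and q
    form a 2-cycle. *)
Lemma sum_peak N (x : 'I_N.+2) :
  \sum_(t | openers x t && (t x < x)%N && ((t^-1)%g x < x)%N)
     wt t x * wt_above x t
  = (lam + x%:R - 1) * (\sum_(xi < x) b (x - 1 - xi)%N xi) * Qpart N x.-1.
Proof.
have yN : (x.-1 < N.+1)%N by have := ltn_ord x; lia.
(* The threshold of the second removal; for x = 0 both sides vanish, no letter being below x. *)
pose y := Ordinal yN.
rewrite (partition_big (fun t : 'S_N.+2 => (t^-1)%g x) (fun p => p < x)%N) /=; last first.
  by move=> t /andP[].
have tV (t : 'S_N.+2) p : ((t^-1)%g x == p) = (t p == x).
  by rewrite (can2_eq (permKV t) (permK t)) eq_sym.
transitivity (\sum_(p : 'I_N.+2 | (p < x)%N)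
    \sum_(s | openers x (ins x p s) && (ins x p s x < x)%N)
    wt (ins x p s) x * wt_above x (ins x p s)).
  apply: eq_bigr => p px; rewrite -(@sum_ins _ _ x p
    (fun t => openers x t && (t x < x)%N) (fun t => wt t x * wt_above x t)).
  apply: eq_bigl => t; rewrite tV; case: eqP => [tp|]; rewrite ?andbF // !andbT.
  have -> : (t^-1)%g x = p by rewrite -tp permK.
  by rewrite px andbT.
rewrite (@big_lift _ _ _ _ x) ?ltnn //.
have lt_lift (i : 'I_N.+1) : (lift x i < x)%N = (i < x)%N by rewrite /= /bump; lia.
rewrite (eq_bigl _ _ lt_lift).
transitivity (\sum_(p : 'I_N.+1 | (p < x)%N) \sum_(q : 'I_N.+1 | (q < x)%N)
    b (x - 1 - q)%N q * lam ^+ (p == q) * Qpart N x.-1).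
  apply: eq_bigr => p px.
  transitivity (\sum_(s : 'S_N.+1 | openers_but y p s && (s p < x)%N)
      b (x - 1 - s p)%N (s p) * wt_above y s).
    have sx (s : 'S_N.+1) : ins x (lift x p) s x = lift x (s p) by apply: ins_out.
    apply: eq_big => [s|s]; rewrite openers_peakE // sx lt_lift // => /andP[sy spx].
    have xs : openers x (ins x (lift x p) s) by rewrite openers_peakE.
    have [|lcE lnE] := lower_stats xs; first by rewrite sx lt_lift.
    have spE : lift x (s p) = s p :> nat by rewrite /= /bump leqNgt spx.
    have Vx : ((ins x (lift x p) s)^-1)%g x = lift x p.
      by apply/eqP; rewrite tV ins_at.
    have px' : (lift x p < x)%N by rewrite lt_lift.
    rewrite wt_above_ins ?(ltnW px') // [lift x p == x]eq_sym (negPf (neq_lift _ _)) mul1r.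
    congr (_ * (_ * _)); last by apply: eq_bigl => i /=; lia.
    rewrite /wt Vx px' lcE lnE sx lt_lift spx spE.
    by rewrite [lift x _ == x]eq_sym (negPf (neq_lift _ _)).
  rewrite (partition_big (fun s : 'S_N.+1 => s p) (fun q => q < x)%N) /=; last first.
    by move=> s /andP[].
  apply: eq_bigr => q qx.
  rewrite -mulrA -(sum_wt_above (x := y)) /=; try lia.
  rewrite mulr_sumr; apply: eq_big => [s|s /andP[_ /eqP ->] //].
  by case: eqP => [->|]; rewrite ?andbF // qx andbT.
rewrite exchange_big /=.
transitivity (\sum_(q < N.+1 | (q < x)%N)
    b (x - 1 - q)%N q * (lam + x%:R - 1) * Qpart N x.-1).
  apply: eq_bigr => q qx.
  by rewrite -mulr_suml -mulr_sumr sum_exp_eq // -ltnS ltn_ord.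
rewrite -!mulr_suml (big_ord_narrow (ltn_ord x : x <= N.+1)%N) /=.
by congr (_ * _); rewrite mulrC.
Qed.

Lemma Qpart_rec N (x : 'I_N.+1) : Qpart N.+1 x =
  a x * Qpart N.+1 x.+1 + gamma c d e lam x * Qpart N x
  + (if nat_of_ord x is h.+1 then
      (lam + x%:R - 1) * (\sum_(xi < x) b (x - 1 - xi)%N xi) * Qpart N.-1 h else 0).
Proof.
have -> : Qpart N.+1 x = \sum_(t | openers x t) wt t x * wt_above x t.
  apply: eq_bigr => t _; rewrite mulrCA (bigD1 x) //=; congr (_ * (_ * _)).
  by apply: eq_bigl => i; rewrite -val_eqE /= [RHS]ltn_neqAle andbC eq_sym.
rewrite (bigID (fun t : 'S_N.+1 => t x == x)) /= sum_fix.
rewrite (bigID (fun t : 'S_N.+1 => (x < t x)%N)) /=.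
rewrite (bigID (fun t : 'S_N.+1 => (x < (t^-1)%g x)%N)) /=.
rewrite [X in _ + (_ + X)](bigID (fun t : 'S_N.+1 => (x < (t^-1)%g x)%N)) /=.
set Sv := \sum_(t | _) _; set Sr := \sum_(t | _) _; set Sf := \sum_(t | _) _.
set Sp := \sum_(t | _) _.
(* Off the fixed points, failing x < t^-1 x thus means t^-1 x < x. *)
have Vfix (t : 'S_N.+1) : ((t^-1)%g x == x :> nat) = (t x == x :> nat).
  by have := perm_fixV t x; rewrite -!val_eqE.
have -> : Sv = a x * Qpart N.+1 x.+1.
  rewrite -sum_val; apply: eq_bigl => t; rewrite -val_eqE /=.
  by case: (openers x t) => //=; have := Vfix t; lia.
have -> : Sr = (\sum_(xi < x) d (x - 1 - xi)%N xi) * Qpart N x.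
  rewrite -sum_drise; apply: eq_bigl => t; rewrite -val_eqE /=.
  by case: (openers x t) => //=; have := Vfix t; lia.
have -> : Sf = (\sum_(xi < x) c (x - 1 - xi)%N xi) * Qpart N x.
  rewrite -sum_dfall; apply: eq_bigl => t; rewrite -val_eqE /=.
  by case: (openers x t) => //=; have := Vfix t; lia.
have -> : Sp = if nat_of_ord x is h.+1 then
    (lam + x%:R - 1) * (\sum_(xi < x) b (x - 1 - xi)%N xi) * Qpart N.-1 h else 0.
  rewrite {}/Sp; transitivity (\sum_(t | openers x t && (t x < x)%N && ((t^-1)%g x < x)%N)
      wt t x * wt_above x t).
    apply: eq_bigl => t; rewrite -val_eqE /=.
    by case: (openers x t) => //=; have := Vfix t; lia.
  (* For N = 0 the letter x is 0 and cannot be a peak, so [N.-1] is a true predecessor whenever it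
     enters. *)
  case: N x {Sv Sr Sf Vfix} => [|N] x; last first.
    rewrite sum_peak; case: x => -[|h] //= _.
    by rewrite big_ord0 mulr0 mul0r.
  have -> : nat_of_ord x = 0%N by case: x => -[].
  by rewrite big1 // => t; rewrite ltn0 andbF.
rewrite /gamma; case: (nat_of_ord x) => [|h]; ring.
Qed.

End Recursion.

Theorem theorem3p3 (R : comNzRingType) (lam : R) (a : nat -> R)
    (b c d : nat -> nat -> R) (e : nat -> R) :
  is_jfraction (gamma c d e lam) (beta a b lam) (Qhat a b c d e lam).
Proof.
(* The weight of a down step from h; an up step from h has weight a_h, so [beta] multiplies an up
   step by the matching down step. *)
pose B h := (lam + h%:R - 1) * (\sum_(xi < h) b (h - 1 - xi)%N xi).
(* Here m is the number of weighted letters, which drops by one in every term of the recurrence: it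
   is the length of the walk. *)
pose W m h := Qpart a b c d e lam (h + m) h.
have W0 h : W 0%N h = (h == 0%N)%:R by rewrite /W addn0 Qpart_diag.
have WS m h : W m.+1 h = a h * W m h.+1 + gamma c d e lam h * W m h
    + (if h is h'.+1 then B h * W m h' else 0).
  have hN : (h < (h + m).+1)%N by rewrite ltnS leq_addr.
  rewrite /W addnS (Qpart_rec _ _ _ _ _ _ (Ordinal hN)) /=; case: h hN => [|h] hN.
    by rewrite !add0n.
  by rewrite /B !addSn.
have betaS h : beta a b lam h.+1 = a h * B h.+1.
  by rewrite /beta /B subSS subn0 mulrAC mulrC.
move=> n; have [M HM] := jfraction_walks W0 WS betaS n.
by exists M => m /HM ->; rewrite /W add0n Qpart0.
Qed.
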